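(* The minimal logic of implicative lattices is sound in the class $\mathbb{L}$ of frames: if $\varphi\vdash\psi$ is provable, then $[\![\varphi]\!]_{\mathfrak{M}}\subseteq[\![\psi]\!]_{\mathfrak{M}}$ for every model $\mathfrak{M}=(\mathfrak{F},V)$ on a frame $\mathfrak{F}\in\mathbb{L}$.
   Context: Logic (integral case, the truth constant being identified with $\top$). Sentences: $\varphi::=p_i\,(i\in\mathbb{N})\mid\top\mid\bot\mid\varphi\wedge\varphi\mid\varphi\vee\varphi\mid\varphi\to\varphi$. Sequents $\varphi\vdash\psi$ are generated by: $\varphi\vdash\varphi$; $\varphi\vdash\top$; $\bot\vdash\varphi$; cut; uniform substitution; the two-way rule $\varphi\vdash\psi$ iff $\top\vdash\varphi\to\psi$; from $\psi\vdash\vartheta$ infer $\varphi\to\psi\vdash\varphi\to\vartheta$ and $\vartheta\to\varphi\vdash\psi\to\varphi$; the usual rules for $\wedge$ as greatest lower bound and for $\vee$ as least upper bound with respect to $\vdash$; and the axioms $(\varphi\to\psi)\wedge(\varphi\to\vartheta)\vdash\varphi\to(\psi\wedge\vartheta)$ and $(\varphi\to\vartheta)\wedge(\psi\to\vartheta)\vdash(\varphi\vee\psi)\to\vartheta$. Frames. $\mathfrak{F}=(W_1,W_\partial,I,T)$: $W_1,W_\partial$ nonempty sets (not necessarily disjoint), $I\subseteq W_1\times W_\partial$, $T\subseteq W_\partial\times(W_1\times W_\partial)$. Let $\perp$ be the complement of $I$. For $A\subseteq W_1$, $A'=\{y\in W_\partial\mid\forall x\in A\;x\perp y\}$; for $B\subseteq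 W_\partial$, $B'=\{x\in W_1\mid\forall y\in B\;x\perp y\}$. Galois sets are subsets $G$ of $W_1$ (stable) or $W_\partial$ (co-stable) with $G=G''$. $Txv=\{y\in W_\partial\mid yTxv\}$; the Galois dual $T'$ is given by $uT'xv$ iff $u\in(Txv)'$. $\mathbb{L}$ is the class of frames satisfying: (F1) for all $x\in W_1,v\in W_\partial$, $Txv$ is a Galois set; (F2) for all $x\in W_1,v\in W_\partial$: $x\perp v$ iff $uT'xv$ for all $u\in W_1$; (F3a) for all $x,z\in W_1$ the section $\{y\in W_\partial\mid xT'zy\}$ is a Galois (co-stable) set; (F3b) for all $x\in W_1$, $v\in W_\partial$ the section $\{z\in W_1\mid xT'zv\}$ is a Galois (stable) set. Models. $V$ assigns a Galois stable set $V(p_i)\subseteq W_1$ to each $p_i$. $[\![p_i]\!]=V(p_i)$, $[\![\top]\!]=W_1$, $[\![\bot]\!]=(W_\partial)'$, $[\![\varphi\wedge\psi]\!]=[\![\varphi]\!]\cap[\![\psi]\!]$, $[\![\varphi\vee\psi]\!]=([\![\varphi]\!]'\cap[\![\psi]\!]')'$, $[\![\varphi\to\psi]\!]=\{u\in W_1\mid\forall x\in[\![\varphi]\!]\,\forall v\in[\![\psi]\!]'\;uT'xv\}$. *)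

(* Defs.v *)
From mathcomp Require Import all_boot.
From mathcomp Require Import boolp classical_sets.

Set Implicit Arguments.
Unset Strict Implicit.
Unset Printing Implicit Defensive.

Local Open Scope classical_set_scope.

Inductive sentence : Type :=
  | Var of nat
  | Top
  | Bot
  | Conj of sentence & sentence
  | Disj of sentence & sentence
  | Impl of sentence & sentence.

Fixpoint subst (s : nat -> sentence) (phi : sentence) : sentence :=
  match phi with
  | Var i => s i
  | Top => Top
  | Bot => Bot
  | Conj a b => Conj (subst s a) (subst s b)
  | Disj a b => Disj (subst s a) (subst s b)
  | Impl a b => Impl (subst s a) (subst s b)
  end.

Reserved Notation "phi ⊢ psi" (at level 70, no associativity).

Inductive provable : sentence -> sentence -> Prop :=
  | prov_refl phi : phi ⊢ phi
  | prov_top phi : phi ⊢ Top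
  | prov_bot phi : Bot ⊢ phi
  | prov_cut phi psi theta : phi ⊢ psi -> psi ⊢ theta -> phi ⊢ theta
  | prov_subst s phi psi : phi ⊢ psi -> subst s phi ⊢ subst s psi
  | prov_impl_intro phi psi : phi ⊢ psi -> Top ⊢ Impl phi psi
  | prov_impl_elim phi psi : Top ⊢ Impl phi psi -> phi ⊢ psi
  | prov_impl_monor phi psi theta :
      psi ⊢ theta -> Impl phi psi ⊢ Impl phi theta
  | prov_impl_antil phi psi theta :
      psi ⊢ theta -> Impl theta phi ⊢ Impl psi phi
  | prov_conj_l phi psi : Conj phi psi ⊢ phi
  | prov_conj_r phi psi : Conj phi psi ⊢ psi
  | prov_conj_glb phi psi theta :
      theta ⊢ phi -> theta ⊢ psi -> theta ⊢ Conj phi psi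
  | prov_disj_l phi psi : phi ⊢ Disj phi psi
  | prov_disj_r phi psi : psi ⊢ Disj phi psi
  | prov_disj_lub phi psi theta :
      phi ⊢ theta -> psi ⊢ theta -> Disj phi psi ⊢ theta
  | prov_impl_conj phi psi theta :
      Conj (Impl phi psi) (Impl phi theta) ⊢ Impl phi (Conj psi theta)
  | prov_impl_disj phi psi theta :
      Conj (Impl phi theta) (Impl psi theta) ⊢ Impl (Disj phi psi) theta
where "phi ⊢ psi" := (provable phi psi).

(* The two sorts are separate types: the only relations between them are
   [incid] and [frT], so a possible overlap of the two carriers plays no role. *)
Record frame : Type := Frame {
  W1 : Type;
  Wd : Type;
  W1_nonempty : [set: W1] !=set0;
  Wd_nonempty : [set: Wd] !=set0;
  incid : W1 -> Wd -> Prop;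
  frT : Wd -> W1 -> Wd -> Prop (* [frT y x v] is yTxv *)
}.

Section FrameNotions.
Variable F : frame.

Definition perp (x : W1 F) (y : Wd F) : Prop := ~ incid x y.

Definition polar1 (A : set (W1 F)) : set (Wd F) :=
  [set y | forall x, A x -> perp x y].

Definition polard (B : set (Wd F)) : set (W1 F) :=
  [set x | forall y, B y -> perp x y].

Definition stable (A : set (W1 F)) : Prop := A = polard (polar1 A).

Definition costable (B : set (Wd F)) : Prop := B = polar1 (polard B).

Definition Tsec (x : W1 F) (v : Wd F) : set (Wd F) := [set y | frT y x v].

Definition Tdual (u x : W1 F) (v : Wd F) : Prop := polard (Tsec x v) u.

Definition axF1 : Prop := forall x v, costable (Tsec x v).

Definition axF2 : Prop := forall x v, perp x v <-> (forall u, Tdual u x v).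

Definition axF3a : Prop := forall x z, costable [set y | Tdual x z y].

Definition axF3b : Prop := forall x v, stable [set z | Tdual x z v].

Definition classL : Prop := [/\ axF1, axF2, axF3a & axF3b].

Record model : Type := Model {
  val_of : nat -> set (W1 F);
  val_stable : forall i, stable (val_of i)
}.

Fixpoint interp (M : model) (phi : sentence) : set (W1 F) :=
  match phi with
  | Var i => val_of M i
  | Top => setT
  | Bot => polard setT
  | Conj a b => interp M a `&` interp M b
  | Disj a b => polard (polar1 (interp M a) `&` polar1 (interp M b))
  | Impl a b =>
      [set u | forall x, interp M a x ->
               forall v, polar1 (interp M b) v -> Tdual u x v]
  end.

End FrameNotions.

(* Main.v *)
(** The clauses for disjunction and implication are polars, so every sentence
    denotes a stable set. Condition (F2) gives the two-way rule for implication.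
    Conditions (F3a) and (F3b) say that [{v | uT'xv}] and [{x | uT'xv}] are
    Galois sets; as such they absorb the Galois closures involved in the
    co-interpretation of a conjunction and in the interpretation of a
    disjunction, which is what the two distribution axioms ask for. *)

Require Import Defs.
From mathcomp Require Import all_boot.
From mathcomp Require Import boolp classical_sets.

Local Open Scope classical_set_scope.

Section Polarity.
Context {F : frame}.
Implicit Types (A : set (W1 F)) (B : set (Wd F)).

Lemma polar1S A1 A2 : A1 `<=` A2 -> polar1 A2 `<=` polar1 A1.
Proof. by move=> sA y yA2 x /sA; exact: yA2. Qed.

Lemma polardS B1 B2 : B1 `<=` B2 -> polard B2 `<=` polard B1.
Proof. by move=> sB x xB2 y /sB; exact: xB2. Qed.

Lemma subset_polar1K A : A `<=` polard (polar1 A).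
Proof. by move=> x Ax y; exact. Qed.

Lemma subset_polardK B : B `<=` polar1 (polard B).
Proof. by move=> y By x; exact. Qed.

Lemma stable_polard B : stable (polard B).
Proof.
apply/seteqP; split; first exact: subset_polar1K.
exact/polardS/subset_polardK.
Qed.

Lemma stableI A1 A2 : stable A1 -> stable A2 -> stable (A1 `&` A2).
Proof.
move=> s1 s2; apply/seteqP; split; first exact: subset_polar1K.
by move=> x xA; split; [rewrite s1 | rewrite s2]; move: x xA;
  apply/polardS/polar1S => x [].
Qed.

(** Since [polar1 A] lies in both polars, a second polar lands inside the closure of [A], which is
    [A]. *)
Lemma polar_meet_sub_stable A1 A2 A : stable A -> A1 `<=` A -> A2 `<=` A ->
  polard (polar1 A1 `&` polar1 A2) `<=` A.
Proof.
move=> -> s1 s2; apply: polardS => y yA.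
by split=> x xA; [exact: s1 xA _ yA | exact: s2 xA _ yA].
Qed.

(** Dualizing the inclusions puts [polard B] inside the closures of [A1] and [A2], hence inside
    their meet; dualizing back gives the closure of [B]. *)
Lemma polar1I_sub_costable A1 A2 B : stable A1 -> stable A2 -> costable B ->
  polar1 A1 `<=` B -> polar1 A2 `<=` B -> polar1 (A1 `&` A2) `<=` B.
Proof.
move=> s1 s2 -> /polardS t1 /polardS t2; apply: polar1S => x xB.
split; [rewrite s1; apply: t1 | rewrite s2; apply: t2];
  exact: subset_polar1K.
Qed.

End Polarity.

Lemma stable_interp {F : frame} (M : model F) phi : stable (interp M phi).
Proof.
elim: phi => [i|||a IHa b IHb|a _ b _|a _ b _] /=.
- exact: val_stable.
- by apply/seteqP; split=> // x _; exact: subset_polar1K.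
- exact: stable_polard.
- exact: stableI.
- exact: stable_polard.
(* [Tdual u x v] is itself a polar condition, so the implication is the polar of a union of sections
   of [frT]. *)
- suff -> : [set u | forall x, interp M a x ->
      forall v, polar1 (interp M b) v -> Tdual u x v] =
    polard [set y | exists x v,
      [/\ interp M a x, polar1 (interp M b) v & Tsec x v y]].
    exact: stable_polard.
  apply/seteqP; split=> u hu.
    by move=> y [x [v [ax bv]]]; exact: hu.
  by move=> x ax v bv y Ty; apply: hu; exists x, v.
Qed.

(** Absorbs a substitution into the valuation. *)
Definition subst_model {F : frame} (M : model F) (s : nat -> sentence) :
  model F := Model (fun i => stable_interp M (s i)).

Lemma interp_subst {F : frame} (M : model F) s phi :
  interp M (subst s phi) = interp (subst_model M s) phi.
Proof. by elim: phi => //= a -> b ->. Qed.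

Theorem theorem6p1 (phi psi : sentence) (Hprov : phi ⊢ psi)
    (F : frame) (HF : classL F) (M : model F) :
  interp M phi `<=` interp M psi.
Proof.
case: HF => _ F2 F3a F3b.
(* The model must vary in the induction because of uniform substitution. *)
elim: Hprov M => {phi psi}.
- by move=> phi M x.
- by move=> phi M x.
- by move=> phi M; rewrite (stable_interp M phi); exact: polardS.
- by move=> phi psi theta _ IH1 _ IH2 M; exact: subset_trans (IH1 M) (IH2 M).
- by move=> s phi psi _ IH M; rewrite !interp_subst; exact: IH.
- move=> phi psi _ IH M u _ x /IH psix v psiv.
  by apply/F2: u; exact: psiv.
- move=> phi psi _ IH M x phix; rewrite (stable_interp M psi) => v psiv.
  (* Every [u] lies in the denotation of [Top], so the right side of (F2) holds in full. *)
  by apply/F2 => u; exact: (IH M u I).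
- move=> phi psi theta _ IH M u hu x phix v thetav.
  by apply: hu => //; exact: polar1S (IH M) _ thetav.
- by move=> phi psi theta _ IH M u hu x /IH; exact: hu.
- by move=> phi psi M x [].
- by move=> phi psi M x [].
- by move=> phi psi theta _ IH1 _ IH2 M x tx; split; [exact: IH1 | exact: IH2].
- by move=> phi psi M x phix y [+ _]; exact.
- by move=> phi psi M x psix y [_]; exact.
- move=> phi psi theta _ IH1 _ IH2 M.
  exact: polar_meet_sub_stable (stable_interp M theta) (IH1 M) (IH2 M).
- move=> phi psi theta M u [h1 h2] x phix.
  (* The co-stable set is the section of all [v] with [Tdual u x v]. *)
  apply: polar1I_sub_costable (F3a u x) _ _; try exact: stable_interp.
    exact: h1.
  exact: h2.
- move=> phi psi theta M u [h1 h2] x phix v thetav.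
  (* Here [u] and [v] are fixed, and the stable set is the section in the middle argument of
     [Tdual]. *)
  by apply: (polar_meet_sub_stable _ _ _ (F3b u v) _ _ x phix) => z hz;
    [exact: h1 | exact: h2].
Qed.
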